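(* Let $a\in\mathbb{R}$, $a\neq 0$. There does not exist a minimal affine factorable surface of type 2, $x=w(y,z)=f_1(y+az)f_2(z)$, in the isotropic space $\mathbb{I}^3$, except non-isotropic planes.
   Context: The 3-dimensional isotropic space $\mathbb{I}^3$ is $\mathbb{R}^3$ with affine coordinates $(x,y,z)$ and the degenerate metric $ds^2=dx^2+dy^2$. An affine factorable surface of type 2 is a graph $x=w(y,z)=f_1(y+az)f_2(z)$, where $a\neq 0$ is a real constant and $f_1,f_2$ are smooth real-valued functions of one variable, defined on open intervals $I_1,I_2$; the point $(y,z)$ ranges over $\{(y,z): y+az\in I_1,\ z\in I_2\}$. The surface is assumed admissible (no isotropic tangent planes, i.e. no tangent planes parallel to the $z$-axis), which means $w_z=af_1'f_2+f_1f_2'\neq 0$ everywhere. For an admissible graph $x=w(y,z)$ the (isotropic) mean curvature is $$H=\frac{w_z^2w_{yy}-2w_yw_zw_{yz}+(1+w_y^2)w_{zz}}{2w_z^3};$$ the surface is minimal if $H$ vanishes identically. A plane $\alpha x+\beta y+\gamma z=\delta$ is non-isotropic if $\gamma\neq 0$; a surface that is (part of) such a plane counts as a non-isotropic plane. *)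

(* Defs.v *)
From Stdlib Require Import Reals.
From Coquelicot Require Import Coquelicot.
Open Scope R_scope.

(** Endpoints range over the extended reals, so unbounded intervals are allowed. *)
Definition open_Rbar_interval (l r : Rbar) (x : R) : Prop := Rbar_lt l x /\ Rbar_lt x r.

(** [f] is total; only its values on the open set [I] matter, since
    [ex_derive_n] is a local property. *)
Definition smooth_on (I : R -> Prop) (f : R -> R) : Prop :=
  forall (n : nat) (x : R), I x -> ex_derive_n f n x.

Definition affine_factorable (a : R) (f1 f2 : R -> R) (y z : R) : R :=
  f1 (y + a * z) * f2 z.

Definition affine_factorable_domain (a : R) (I1 I2 : R -> Prop) (y z : R) : Prop :=
  I1 (y + a * z) /\ I2 z.

Definition D_y (w : R -> R -> R) (y z : R) : R := Derive (fun t => w t z) y.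
Definition D_z (w : R -> R -> R) (y z : R) : R := Derive (fun t => w y t) z.

(** The graph x = w(y,z) has no tangent plane parallel to the z-axis. *)
Definition admissible (D : R -> R -> Prop) (w : R -> R -> R) : Prop :=
  forall y z : R, D y z -> D_z w y z <> 0.

Definition isotropic_mean_curvature (w : R -> R -> R) (y z : R) : R :=
  let wy := D_y w y z in
  let wz := D_z w y z in
  let wyy := D_y (D_y w) y z in
  let wyz := D_z (D_y w) y z in
  let wzz := D_z (D_z w) y z in
  (wz ^ 2 * wyy - 2 * wy * wz * wyz + (1 + wy ^ 2) * wzz) / (2 * wz ^ 3).

Definition minimal (D : R -> R -> Prop) (w : R -> R -> R) : Prop :=
  forall y z : R, D y z -> isotropic_mean_curvature w y z = 0.

(** Surfaces as subsets of the space with coordinates (x,y,z). *)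
Definition graph_surface (D : R -> R -> Prop) (w : R -> R -> R) (x y z : R) : Prop :=
  D y z /\ x = w y z.

Definition part_of_nonisotropic_plane (S : R -> R -> R -> Prop) : Prop :=
  exists alpha beta gamma delta : R,
    gamma <> 0 /\
    forall x y z : R, S x y z -> alpha * x + beta * y + gamma * z = delta.

(* Main.v *)
Require Import Defs.
From Stdlib Require Import Reals Lra Classical.
From Coquelicot Require Import Coquelicot.
Open Scope R_scope.

(** In the independent variables [u = y + a z] and [v = z] the domain becomes a
    rectangle, [w = f(u) g(v)], and minimality reads
    [(a^2 + f^2 g'^2) f'' g + 2 (a - f f' g g') f' g' + (1 + f'^2 g^2) f g'' = 0]
    (lemma [minimal_separated]).  The heart of the proof is that [f' g']
    vanishes identically ([one_factor_constant]).  Then one factor is constant,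
    the equation says that the other has zero second derivative, and the
    surface lies in a plane, non-isotropic by admissibility.

    Suppose [f'(u) g'(v) <> 0] somewhere.  On the open sets where
    [f, f', g, g'] do not vanish, put [x = f^2], [b = f / f'], [p = b'] and
    [y = g^2], [c = a g / g'], [q = c' / a].  Dividing by suitable powers, the
    equation becomes the symmetric relation
    [c^2 (1 - p) + b^2 (1 - q) - x y (p + q) + 2 b c = 0],
    while admissibility becomes [b + c <> 0].  This is a bilinear relation of
    length five between functions of [u] and functions of [v], so the two
    families of functions span spaces whose dimensions add up to at most five,
    and one of them has dimension at most two.  Neither [y, c] nor [x, b] can
    be proportional ([minimal_profiles_independent]); hence either [c^2] and
    [1 - q] are combinations of [y] and [c], or the same holds with [x, b, p]
    ([span_dichotomy], [span_exchange]).  Together with the differential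
    relation [y' = 2 a y / c] this is algebraic enough to leave only an affine
    or an exponential factor.  For an affine factor the term [2 b c] would have
    to vanish, and for an exponential one [(b + c)^2 = 0], both impossible
    ([minimal_profiles_span_absurd]). *)

(** * Spans of two functions *)

(** [h] is a linear combination, with constant coefficients, of [h1] and [h2] on [I]. *)
Definition in_span (I : R -> Prop) (h1 h2 h : R -> R) : Prop :=
  exists l m : R, forall t, I t -> h t = l * h1 t + m * h2 t.

(** Linear independence of two functions on [I], witnessed by a nonzero 2x2 minor. *)
Definition independent (I : R -> Prop) (h1 h2 : R -> R) : Prop :=
  exists t1 t2 : R, I t1 /\ I t2 /\ h1 t1 * h2 t2 - h1 t2 * h2 t1 <> 0.

Lemma in_span_left I h1 h2 : in_span I h1 h2 h1.
Proof. exists 1, 0; intros; ring. Qed.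

Lemma in_span_right I h1 h2 : in_span I h1 h2 h2.
Proof. exists 0, 1; intros; ring. Qed.

Lemma span_exchange I h1 h2 b1 b2 h :
  in_span I h1 h2 b1 -> in_span I h1 h2 b2 -> independent I b1 b2 ->
  in_span I h1 h2 h -> in_span I b1 b2 h.
Proof.
  intros (l1 & m1 & E1) (l2 & m2 & E2) (t1 & t2 & I1 & I2 & D) (l & m & E).
  assert (d : l1 * m2 - m1 * l2 <> 0).
  { intro K; apply D.
    rewrite (E1 t1 I1), (E1 t2 I2), (E2 t1 I1), (E2 t2 I2).
    replace (_ - _) with ((l1 * m2 - m1 * l2) * (h1 t1 * h2 t2 - h1 t2 * h2 t1)) by ring.
    rewrite K; ring. }
  exists ((l * m2 - m * l2) / (l1 * m2 - m1 * l2)),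
         ((l1 * m - m1 * l) / (l1 * m2 - m1 * l2)).
  intros t It. rewrite (E t It), (E1 t It), (E2 t It). field. exact d.
Qed.

(** A bilinear relation of length five forces one of the two families of
    functions to be small: by Cramer's rule, a nonzero 3x3 minor of
    [Y1, Y2, Y3] expresses [X2] and [X3] (and also [X1]) through [X4] and [X5]. *)
Lemma span_dichotomy (I J : R -> Prop) (X1 X2 X3 X4 X5 Y1 Y2 Y3 Y4 Y5 : R -> R) :
  (forall u v, I u -> J v ->
     X1 u * Y1 v + X2 u * Y2 v + X3 u * Y3 v + X4 u * Y4 v + X5 u * Y5 v = 0) ->
  independent J Y1 Y2 ->
  in_span J Y1 Y2 Y3 \/ (in_span I X4 X5 X2 /\ in_span I X4 X5 X3).
Proof.
  intros E (v1 & v2 & J1 & J2 & D).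
  set (det := fun v => Y1 v1 * (Y2 v2 * Y3 v - Y2 v * Y3 v2)
                     - Y1 v2 * (Y2 v1 * Y3 v - Y2 v * Y3 v1)
                     + Y1 v * (Y2 v1 * Y3 v2 - Y2 v2 * Y3 v1)).
  destruct (classic (forall v, J v -> det v = 0)) as [H | H].
  - left.
    exists ((Y3 v1 * Y2 v2 - Y3 v2 * Y2 v1) / (Y1 v1 * Y2 v2 - Y1 v2 * Y2 v1)),
           ((Y1 v1 * Y3 v2 - Y1 v2 * Y3 v1) / (Y1 v1 * Y2 v2 - Y1 v2 * Y2 v1)).
    intros v Jv. specialize (H v Jv). unfold det in H.
    apply (Rmult_eq_reg_l (Y1 v1 * Y2 v2 - Y1 v2 * Y2 v1)); [ | exact D].
    field_simplify; [ | exact D]. lra.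
  - right.
    apply not_all_ex_not in H; destruct H as [v3 H].
    apply imply_to_and in H; destruct H as [J3 H].
    split.
    (* [k1], [k2], [k3] are the 2x2 minors complementary to the column of [Y2],
       then of [Y3]. *)
    + set (k1 := Y1 v2 * Y3 v3 - Y1 v3 * Y3 v2).
      set (k2 := Y1 v1 * Y3 v3 - Y1 v3 * Y3 v1).
      set (k3 := Y1 v1 * Y3 v2 - Y1 v2 * Y3 v1).
      exists ((k1 * Y4 v1 - k2 * Y4 v2 + k3 * Y4 v3) / det v3),
             ((k1 * Y5 v1 - k2 * Y5 v2 + k3 * Y5 v3) / det v3).
      intros u Iu.
      generalize (E u v1 Iu J1) (E u v2 Iu J2) (E u v3 Iu J3); intros e1 e2 e3.
      apply (Rmult_eq_reg_l (det v3)); [ | exact H].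
      field_simplify; [ | exact H].
      apply Rminus_diag_uniq.
      replace (_ - _) with
        (- k1 * (X1 u * Y1 v1 + X2 u * Y2 v1 + X3 u * Y3 v1 + X4 u * Y4 v1 + X5 u * Y5 v1)
         + k2 * (X1 u * Y1 v2 + X2 u * Y2 v2 + X3 u * Y3 v2 + X4 u * Y4 v2 + X5 u * Y5 v2)
         - k3 * (X1 u * Y1 v3 + X2 u * Y2 v3 + X3 u * Y3 v3 + X4 u * Y4 v3 + X5 u * Y5 v3))
        by (unfold det, k1, k2, k3; ring).
      rewrite e1, e2, e3; ring.
    + set (k1 := Y1 v2 * Y2 v3 - Y1 v3 * Y2 v2).
      set (k2 := Y1 v1 * Y2 v3 - Y1 v3 * Y2 v1).
      set (k3 := Y1 v1 * Y2 v2 - Y1 v2 * Y2 v1).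
      exists (- (k1 * Y4 v1 - k2 * Y4 v2 + k3 * Y4 v3) / det v3),
             (- (k1 * Y5 v1 - k2 * Y5 v2 + k3 * Y5 v3) / det v3).
      intros u Iu.
      generalize (E u v1 Iu J1) (E u v2 Iu J2) (E u v3 Iu J3); intros e1 e2 e3.
      apply (Rmult_eq_reg_l (det v3)); [ | exact H].
      field_simplify; [ | exact H].
      apply Rminus_diag_uniq.
      replace (_ - _) with
        (k1 * (X1 u * Y1 v1 + X2 u * Y2 v1 + X3 u * Y3 v1 + X4 u * Y4 v1 + X5 u * Y5 v1)
         - k2 * (X1 u * Y1 v2 + X2 u * Y2 v2 + X3 u * Y3 v2 + X4 u * Y4 v2 + X5 u * Y5 v2)
         + k3 * (X1 u * Y1 v3 + X2 u * Y2 v3 + X3 u * Y3 v3 + X4 u * Y4 v3 + X5 u * Y5 v3))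
        by (unfold det, k1, k2, k3; ring).
      rewrite e1, e2, e3; ring.
Qed.

(** * Identities on open sets *)

(** Given [D : is_derive h t d], replaces the derivative of [h] at [t] by [d],
    also when [h] is eta-expanded. *)
Ltac rewrite_derive D :=
  match type of D with
  | is_derive ?h ?t ?d =>
      replace (Derive (fun s => h s) t) with d
        by (symmetry; apply is_derive_unique; exact D)
  end.

Lemma is_derive_eq_on (I : R -> Prop) (h1 h2 : R -> R) (t l1 l2 : R) :
  open I -> I t -> (forall s, I s -> h1 s = h2 s) ->
  is_derive h1 t l1 -> is_derive h2 t l2 -> l1 = l2.
Proof.
  intros O It E D1 D2.
  rewrite <- (is_derive_unique _ _ _ D1), <- (is_derive_unique _ _ _ D2).
  apply Derive_ext_loc.
  apply (filter_imp I); [exact E | exact (O t It)].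
Qed.

(** A polynomial that vanishes along a function with nonvanishing derivative has
    zero coefficients: differentiate the identity.  The open set need not be
    connected. *)
Lemma quadratic_eq0 (I : R -> Prop) (h dh : R -> R) (k0 k1 k2 : R) :
  open I -> (exists t, I t) ->
  (forall t, I t -> is_derive h t (dh t)) -> (forall t, I t -> dh t <> 0) ->
  (forall t, I t -> k0 + k1 * h t + k2 * h t ^ 2 = 0) ->
  k0 = 0 /\ k1 = 0 /\ k2 = 0.
Proof.
  intros O [t0 I0] D N E.
  assert (E1 : forall t, I t -> k1 + 2 * k2 * h t = 0).
  { intros t It.
    assert (K : dh t * (k1 + 2 * k2 * h t) = 0).
    { apply (is_derive_eq_on I (fun s => k0 + k1 * h s + k2 * h s ^ 2) (fun _ => 0) t); auto.
      - generalize (D t It); intro Dt. auto_derive.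
        + repeat split; exists (dh t); exact Dt.
        + rewrite_derive Dt; ring.
      - apply (is_derive_const 0 t). }
    apply Rmult_integral in K; destruct K as [K | K]; [ | exact K].
    destruct (N t It K). }
  assert (K2 : dh t0 * (2 * k2) = 0).
  { apply (is_derive_eq_on I (fun s => k1 + 2 * k2 * h s) (fun _ => 0) t0); auto.
    - generalize (D t0 I0); intro Dt. auto_derive.
      + repeat split; exists (dh t0); exact Dt.
      + rewrite_derive Dt; ring.
    - apply (is_derive_const 0 t0). }
  apply Rmult_integral in K2; destruct K2 as [K | K]; [destruct (N t0 I0 K) | ].
  assert (k2 = 0) by lra. subst k2.
  generalize (E1 t0 I0) (E t0 I0); intros. assert (k1 = 0) by lra. subst k1.
  repeat split; lra.
Qed.

Lemma cubic_eq0 (I : R -> Prop) (h dh : R -> R) (k0 k1 k2 k3 : R) :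
  open I -> (exists t, I t) ->
  (forall t, I t -> is_derive h t (dh t)) -> (forall t, I t -> dh t <> 0) ->
  (forall t, I t -> k0 + k1 * h t + k2 * h t ^ 2 + k3 * h t ^ 3 = 0) ->
  k0 = 0.
Proof.
  intros O X D N E.
  assert (K : k1 = 0 /\ 2 * k2 = 0 /\ 3 * k3 = 0).
  { apply (quadratic_eq0 I h dh); auto.
    intros t It.
    assert (K : dh t * (k1 + 2 * k2 * h t + 3 * k3 * h t ^ 2) = 0).
    { apply (is_derive_eq_on I
        (fun s => k0 + k1 * h s + k2 * h s ^ 2 + k3 * h s ^ 3) (fun _ => 0) t); auto.
      - generalize (D t It); intro Dt. auto_derive.
        + repeat split; exists (dh t); exact Dt.
        + rewrite_derive Dt; ring.
      - apply (is_derive_const 0 t). }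
    apply Rmult_integral in K; destruct K as [K | K]; [ | exact K].
    destruct (N t It K). }
  destruct K as (K1 & K2 & K3). destruct X as [t It]. generalize (E t It).
  assert (k2 = 0) by lra. assert (k3 = 0) by lra. subst. intro; lra.
Qed.

(** * The separated equation *)

(** The data attached to one factor [f] on an open set where neither [f] nor
    [f'] vanishes: [x = f^2], [b = k f / f'] and [p = b' / k].  The factor itself
    enters only through [x' = 2 k x / b].  The scale [k] lets both factors of the
    surface have the same form. *)
Definition profile (I : R -> Prop) (k : R) (x b p : R -> R) : Prop :=
  k <> 0 /\ open I /\ (exists t, I t) /\
  forall t, I t ->
    x t <> 0 /\ b t <> 0 /\
    is_derive x t (2 * k * x t / b t) /\ is_derive b t (k * p t).

(** The minimal surface equation for two profiles; it is symmetric in them. *)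
Definition minimal_profiles (I J : R -> Prop) (x b p y c q : R -> R) : Prop :=
  forall u v, I u -> J v ->
    c v ^ 2 * (1 - p u) + b u ^ 2 * (1 - q v) - x u * y v * (p u + q v)
    + 2 * b u * c v = 0.

Lemma minimal_profiles_sym I J x b p y c q :
  minimal_profiles I J x b p y c q -> minimal_profiles J I y c q x b p.
Proof. intros H v u Jv Iu. rewrite <- (H u v Iu Jv). ring. Qed.

Lemma profile_square_derive_neq0 I k x b p :
  profile I k x b p -> forall t, I t -> 2 * k * x t / b t <> 0.
Proof.
  intros (k0 & _ & _ & P) t It. destruct (P t It) as (x0 & b0 & _).
  unfold Rdiv. repeat apply Rmult_integral_contrapositive_currified; auto; try lra.
  apply Rinv_neq_0_compat; exact b0.
Qed.

(** Proportional [y] and [c] would mean that [c' / k = 2], and then the term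
    [b^2 (1 - q)] is the constant coefficient of a polynomial in [y]. *)
Lemma minimal_profiles_independent I J k k' x b p y c q :
  profile I k x b p -> profile J k' y c q -> minimal_profiles I J x b p y c q ->
  independent J y c.
Proof.
  intros (_ & _ & (u & Iu) & PI) PJ E.
  destruct (PJ) as (k0 & OJ & (v0 & J0) & P).
  apply NNPP; intro N.
  set (m := c v0 / y v0).
  destruct (P v0 J0) as (y0 & c0 & _).
  assert (C : forall v, J v -> c v = m * y v).
  { intros v Jv. unfold m.
    destruct (Req_dec (y v0 * c v - y v * c v0) 0) as [K | K].
    - apply (Rmult_eq_reg_l (y v0)); [ | exact y0]. field_simplify; [lra | exact y0].
    - destruct N. exists v0, v; auto. }
  (* Differentiate [c = m y]: [k' q = m 2 k' y / c = 2 k']. *)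
  assert (Q : forall v, J v -> q v = 2).
  { intros v Jv. destruct (P v Jv) as (yv & cv & Dy & Dc).
    assert (K : k' * q v = m * (2 * k' * y v / c v)).
    { apply (is_derive_eq_on J c (fun s => m * y s) v); auto.
      apply (is_derive_scal y v m _ Dy). }
    apply (Rmult_eq_reg_l k'); [ | exact k0]. rewrite K.
    replace (m * (2 * k' * y v / c v)) with (2 * k' * (m * y v) / c v) by (field; auto).
    rewrite <- (C v Jv). field; auto. }
  destruct (quadratic_eq0 J y (fun v => 2 * k' * y v / c v) (- b u ^ 2)
     (2 * b u * m - x u * (p u + 2)) (m ^ 2 * (1 - p u))) as [K _]; auto.
  - exists v0; exact J0.
  - intros v Jv; apply P; exact Jv.
  - exact (profile_square_derive_neq0 _ _ _ _ _ PJ).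
  - intros v Jv. rewrite <- (E u v Iu Jv), (Q v Jv), (C v Jv). ring.
  - destruct (PI u Iu) as (_ & b0 & _). apply (pow_nonzero _ 2 b0). lra.
Qed.

(** The first span hypothesis is an equation [c^2 = alpha y + beta c], whose
    derivative gives [q (2 c - beta) = 2 (c - beta)].  If [beta = 0], the
    factor is affine; if [alpha = 0], it is exponential; otherwise the second
    span hypothesis makes [beta] the constant coefficient of a cubic in [c]
    that vanishes identically. *)
Lemma minimal_profiles_span_absurd I J k k' x b p y c q :
  profile I k x b p -> profile J k' y c q -> minimal_profiles I J x b p y c q ->
  (forall u v, I u -> J v -> b u + c v <> 0) ->
  in_span J y c (fun v => c v ^ 2) -> in_span J y c (fun v => 1 - q v) -> False.
Proof.
  intros (_ & _ & (u & Iu) & PI) PJ E A (al & be & S1) (ga & de & S2).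
  destruct (PI u Iu) as (x0 & b0 & _).
  destruct (PJ) as (k0 & OJ & XJ & P).
  assert (Q : forall v, J v -> q v * (2 * c v - be) = 2 * (c v - be)).
  { intros v Jv. destruct (P v Jv) as (yv & cv & Dy & Dc).
    assert (K : 2 * c v * (k' * q v) = al * (2 * k' * y v / c v) + be * (k' * q v)).
    { apply (is_derive_eq_on J (fun s => c s ^ 2) (fun s => al * y s + be * c s) v); auto.
      - auto_derive; [exists (k' * q v); exact Dc | ].
        rewrite_derive Dc; ring.
      - auto_derive; [split; [exists (2 * k' * y v / c v); exact Dy
                             | split; [exists (k' * q v); exact Dc | exact Logic.I]] | ].
        rewrite_derive Dc; rewrite_derive Dy; ring. }
    generalize (S1 v Jv); cbv beta; intro s1.
    assert (K' : al * (2 * k' * y v / c v) = 2 * k' * (c v - be)).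
    { replace (al * (2 * k' * y v / c v)) with (2 * k' * (al * y v) / c v) by (field; auto).
      replace (al * y v) with (c v ^ 2 - be * c v) by lra. field; auto. }
    rewrite K' in K. apply (Rmult_eq_reg_l k'); [lra | exact k0]. }
  destruct (Req_dec be 0) as [Be | Be].
  - (* Here [c^2 = al y] and [q = 1]: the coefficient of [c] is [2 b]. *)
    subst be.
    assert (Q1 : forall v, J v -> q v = 1).
    { intros v Jv. destruct (P v Jv) as (_ & cv & _).
      generalize (Q v Jv); intro K. apply (Rmult_eq_reg_r (2 * c v)); lra. }
    assert (a0 : al <> 0).
    { intro; subst al. destruct XJ as [v Jv]. destruct (P v Jv) as (_ & cv & _).
      generalize (S1 v Jv); cbv beta; intro. apply (pow_nonzero _ 2 cv). lra. }
    destruct (quadratic_eq0 J c (fun v => k' * q v) 0 (2 * b u)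
       ((1 - p u) - x u * (p u + 1) / al)) as (_ & K & _); auto.
    + intros v Jv; apply P; exact Jv.
    + intros v Jv; rewrite (Q1 v Jv); lra.
    + intros v Jv. etransitivity; [ | exact (E u v Iu Jv)]. rewrite (Q1 v Jv).
      replace (y v) with (c v ^ 2 / al)
        by (rewrite (S1 v Jv); field; exact a0).
      field; exact a0.
    + lra.
  - destruct (Req_dec al 0) as [Al | Al].
    + (* Here [c = be] is constant and [q = 0]: the coefficients of the
         polynomial in [y] give [p = 0], then [(b + be)^2 = 0]. *)
      subst al.
      assert (C : forall v, J v -> c v = be).
      { intros v Jv. destruct (P v Jv) as (_ & cv & _).
        generalize (S1 v Jv); cbv beta; intro.
        apply (Rmult_eq_reg_l (c v)); [lra | exact cv]. }
      assert (Q0 : forall v, J v -> q v = 0).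
      { intros v Jv. generalize (Q v Jv); rewrite (C v Jv); intro K.
        apply (Rmult_eq_reg_r be); lra. }
      destruct (quadratic_eq0 J y (fun v => 2 * k' * y v / c v)
        (be ^ 2 * (1 - p u) + b u ^ 2 + 2 * b u * be) (- (x u * p u)) 0)
        as (K0 & K1 & _); auto.
      * intros v Jv; apply P; exact Jv.
      * exact (profile_square_derive_neq0 _ _ _ _ _ PJ).
      * intros v Jv. etransitivity; [ | exact (E u v Iu Jv)]. rewrite (Q0 v Jv), (C v Jv). ring.
      * assert (p0 : p u = 0) by (apply (Rmult_eq_reg_l (x u)); [lra | exact x0]).
        rewrite p0 in K0. destruct XJ as [v Jv].
        generalize (A u v Iu Jv); rewrite (C v Jv); intro N.
        apply (pow_nonzero _ 2 N). lra.
    + (* Substitute [y = c (c - be) / al] and [1 - q = ga y + de c] in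
         [(2 c - be) (1 - q) = be]. *)
      apply Be.
      apply (cubic_eq0 J c (fun v => k' * q v) be
        (- be ^ 2 * ga / al + be * de) (3 * be * ga / al - 2 * de) (- 2 * ga / al)); auto.
      * intros v Jv; apply P; exact Jv.
      * intros v Jv K. destruct (P v Jv) as (yv & cv & _).
        assert (q0 : q v = 0) by (apply (Rmult_eq_reg_l k'); lra).
        generalize (Q v Jv) (S1 v Jv); rewrite q0; cbv beta; intros K1 K2.
        assert (cb : c v = be) by lra. rewrite cb in K2.
        apply (Rmult_integral_contrapositive_currified _ _ Al yv). lra.
      * intros v Jv.
        generalize (Q v Jv) (S1 v Jv) (S2 v Jv); cbv beta; intros K1 K2 K3.
        assert (Y : y v = (c v ^ 2 - be * c v) / al) by (rewrite K2; field; exact Al).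
        assert (K4 : (2 * c v - be) * (1 - q v) = be) by lra.
        rewrite K3, Y in K4. rewrite <- K4 at 1. field; exact Al.
Qed.

(** Both span hypotheses are obtained, for one of the two profiles, by applying
    [span_dichotomy] to [(y, c, c^2)] and to [(y, c, 1 - q)].  If it fails to
    place the third function in the span, it places [b] and the remaining
    coefficient functions in the span of [(b^2, x)], or of [(1 - p, x)], and
    [x, b] is then another basis of that span. *)
Lemma minimal_profiles_absurd I J k k' x b p y c q :
  profile I k x b p -> profile J k' y c q -> minimal_profiles I J x b p y c q ->
  (forall u v, I u -> J v -> b u + c v <> 0) -> False.
Proof.
  intros PI PJ E A.
  assert (E' := minimal_profiles_sym _ _ _ _ _ _ _ _ E).
  assert (A' : forall v u, J v -> I u -> c v + b u <> 0)
    by (intros v u Jv Iu; rewrite Rplus_comm; auto).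
  assert (NJ := minimal_profiles_independent _ _ _ _ _ _ _ _ _ _ PI PJ E).
  assert (NI := minimal_profiles_independent _ _ _ _ _ _ _ _ _ _ PJ PI E').
  destruct (span_dichotomy I J
    (fun u => - (x u * p u)) (fun u => 2 * b u) (fun u => 1 - p u)
    (fun u => b u ^ 2) x
    y c (fun v => c v ^ 2) (fun v => 1 - q v) (fun v => - (y v * q v)))
    as [S1 | [S1 S2]]; auto.
  { intros u v Iu Jv. rewrite <- (E u v Iu Jv). ring. }
  2:{ apply (minimal_profiles_span_absurd _ _ _ _ _ _ _ _ _ _ PJ PI E' A');
      apply (span_exchange I (fun u => b u ^ 2) x); auto using in_span_left, in_span_right;
      destruct S1 as (l & m & S1); exists (l / 2), (m / 2);
      intros t It; generalize (S1 t It); cbv beta; lra. }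
  destruct (span_dichotomy I J
    (fun u => - (x u * p u)) (fun u => 2 * b u) (fun u => b u ^ 2)
    (fun u => 1 - p u) x
    y c (fun v => 1 - q v) (fun v => c v ^ 2) (fun v => - (y v * q v)))
    as [S2 | [S2 S3]]; auto.
  { intros u v Iu Jv. rewrite <- (E u v Iu Jv). ring. }
  2:{ apply (minimal_profiles_span_absurd _ _ _ _ _ _ _ _ _ _ PJ PI E' A');
      apply (span_exchange I (fun u => 1 - p u) x); auto using in_span_left, in_span_right;
      destruct S2 as (l & m & S2); exists (l / 2), (m / 2);
      intros t It; generalize (S2 t It); cbv beta; lra. }
  exact (minimal_profiles_span_absurd _ _ _ _ _ _ _ _ _ _ PI PJ E A S1 S2).
Qed.

(** * Smooth functions on open intervals *)

Lemma open_Rbar_interval_open l r : open (open_Rbar_interval l r).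
Proof.
  intros x [H1 H2].
  apply filter_and; [exact (open_Rbar_gt' x l H1) | exact (open_Rbar_lt' x r H2)].
Qed.

Lemma open_Rbar_interval_inhabited l r :
  Rbar_lt l r -> exists x, open_Rbar_interval l r x.
Proof.
  unfold open_Rbar_interval.
  destruct l as [l | | ], r as [r | | ]; simpl; intro H; try easy.
  - exists ((l + r) / 2); lra.
  - exists (l + 1); lra.
  - exists (r - 1); lra.
  - exists 0; auto.
Qed.

Lemma open_Rbar_interval_convex l r s t z :
  open_Rbar_interval l r s -> open_Rbar_interval l r t -> s <= z <= t ->
  open_Rbar_interval l r z.
Proof.
  intros [H1 _] [_ H2] [A B]. split.
  - apply Rbar_lt_le_trans with s; auto.
  - apply Rbar_le_lt_trans with t; auto.
Qed.

Lemma smooth_on_is_derive l r f t :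
  smooth_on (open_Rbar_interval l r) f -> open_Rbar_interval l r t ->
  is_derive f t (Derive f t).
Proof. intros S It. apply Derive_correct. exact (S 1%nat t It). Qed.

Lemma smooth_on_is_derive2 l r f t :
  smooth_on (open_Rbar_interval l r) f -> open_Rbar_interval l r t ->
  is_derive (Derive f) t (Derive (Derive f) t).
Proof. intros S It. apply Derive_correct. exact (S 2%nat t It). Qed.

Lemma constant_on_interval l r (h : R -> R) :
  (forall t, open_Rbar_interval l r t -> is_derive h t 0) ->
  forall s t, open_Rbar_interval l r s -> open_Rbar_interval l r t -> h s = h t.
Proof.
  intros D.
  assert (L : forall s t, open_Rbar_interval l r s -> open_Rbar_interval l r t ->
                s < t -> h s = h t).
  { intros s t Is It st. apply (eq_is_derive h s t); [ | exact st].
    intros z Hz. apply D. exact (open_Rbar_interval_convex l r s t z Is It Hz). }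
  intros s t Is It. destruct (Rtotal_order s t) as [K | [K | K]].
  - auto.
  - rewrite K; reflexivity.
  - symmetry; auto.
Qed.

Lemma affine_on_interval l r (h : R -> R) :
  Rbar_lt l r -> smooth_on (open_Rbar_interval l r) h ->
  (forall t, open_Rbar_interval l r t -> Derive (Derive h) t = 0) ->
  exists m k, forall t, open_Rbar_interval l r t -> Derive h t = m /\ h t = m * t + k.
Proof.
  intros lr S D.
  destruct (open_Rbar_interval_inhabited l r lr) as [t0 I0].
  assert (M : forall t, open_Rbar_interval l r t -> Derive h t = Derive h t0).
  { intros t It. apply (constant_on_interval l r); auto.
    intros s Is. rewrite <- (D s Is). exact (smooth_on_is_derive2 l r h s S Is). }
  exists (Derive h t0), (h t0 - Derive h t0 * t0).
  intros t It. split; [exact (M t It) | ].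
  cut (h t - Derive h t0 * t = h t0 - Derive h t0 * t0); [lra | ].
  apply (constant_on_interval l r (fun s => h s - Derive h t0 * s)); auto.
  intros s Is. generalize (smooth_on_is_derive l r h s S Is); intro Ds.
  auto_derive; [exists (Derive h s); exact Ds | ].
  rewrite_derive Ds; rewrite (M s Is); ring.
Qed.

(** * Reduction to profiles *)

(** The part of the interval where both [f] and [f'] are nonzero. *)
Definition regular_set (l r : Rbar) (f : R -> R) (t : R) : Prop :=
  open_Rbar_interval l r t /\ f t <> 0 /\ Derive f t <> 0.

Lemma locally_neq0 (h : R -> R) (t d : R) :
  is_derive h t d -> h t <> 0 -> locally t (fun s => h s <> 0).
Proof.
  intros D N.
  assert (C : continuous (U := R_UniformSpace) h t)
    by (apply (ex_derive_continuous (K := R_AbsRing) (V := R_NormedModule)); exists d; exact D).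
  apply (C (fun z => z <> 0)). exact (open_neq 0 (h t) N).
Qed.

Lemma regular_set_open l r f :
  smooth_on (open_Rbar_interval l r) f -> open (regular_set l r f).
Proof.
  intros S t (It & f0 & df0).
  apply filter_and; [ | apply filter_and].
  - exact (open_Rbar_interval_open l r t It).
  - exact (locally_neq0 f t _ (smooth_on_is_derive l r f t S It) f0).
  - exact (locally_neq0 _ t _ (smooth_on_is_derive2 l r f t S It) df0).
Qed.

(** Where [f'] is nonzero, [f] cannot vanish identically nearby. *)
Lemma regular_set_inhabited l r f t :
  smooth_on (open_Rbar_interval l r) f -> open_Rbar_interval l r t ->
  Derive f t <> 0 -> exists s, regular_set l r f s.
Proof.
  intros S It df0. apply NNPP; intro N. apply df0.
  rewrite <- (Derive_const 0 t).
  apply Derive_ext_loc.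
  generalize (filter_and _ _ (open_Rbar_interval_open l r t It)
    (locally_neq0 _ t _ (smooth_on_is_derive2 l r f t S It) df0)).
  apply filter_imp. intros s [Is ds]. apply NNPP; intro fs.
  apply N; exists s; repeat split; auto; apply Is.
Qed.

Lemma regular_set_profile l r f k t :
  smooth_on (open_Rbar_interval l r) f -> open_Rbar_interval l r t ->
  Derive f t <> 0 -> k <> 0 ->
  profile (regular_set l r f) k (fun s => f s ^ 2) (fun s => k * f s / Derive f s)
    (fun s => 1 - f s * Derive (Derive f) s / Derive f s ^ 2).
Proof.
  intros S It df0 k0. split; [exact k0 | split; [ | split]].
  - apply regular_set_open; exact S.
  - apply (regular_set_inhabited l r f t); auto.
  - intros s (Is & f0 & d0).
    generalize (smooth_on_is_derive l r f s S Is)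
               (smooth_on_is_derive2 l r f s S Is); intros D1 D2.
    split; [ | split; [ | split]].
    + apply pow_nonzero; exact f0.
    + apply Rmult_integral_contrapositive_currified.
      * apply Rmult_integral_contrapositive_currified; auto.
      * apply Rinv_neq_0_compat; exact d0.
    + auto_derive; [eexists; exact D1 | ]. rewrite_derive D1. field. auto.
    + auto_derive.
      * repeat split; auto; eexists; [exact D1 | exact D2].
      * rewrite_derive D1. rewrite_derive D2. field. auto.
Qed.

(** * Derivatives of an affine factorable graph *)

Section Graph.

Variables (a : R) (l1 r1 l2 r2 : Rbar) (f g : R -> R).
Let I1 := open_Rbar_interval l1 r1.
Let I2 := open_Rbar_interval l2 r2.
Hypothesis hf : smooth_on I1 f.
Hypothesis hg : smooth_on I2 g.
Let w := affine_factorable a f g.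

Lemma is_derive_shift_y (h : R -> R) (y z d : R) :
  is_derive h (y + a * z) d -> is_derive (fun t => h (t + a * z)) y d.
Proof.
  intro D. auto_derive; [exists d; exact D | ].
  rewrite_derive D; ring.
Qed.

Lemma is_derive_shift_z (h : R -> R) (y z d : R) :
  is_derive h (y + a * z) d -> is_derive (fun t => h (y + a * t)) z (a * d).
Proof.
  intro D. auto_derive; [exists d; exact D | ].
  rewrite_derive D; ring.
Qed.

Lemma is_derive_product (h1 h2 : R -> R) (t d1 d2 : R) :
  is_derive h1 t d1 -> is_derive h2 t d2 ->
  is_derive (fun s => h1 s * h2 s) t (d1 * h2 t + h1 t * d2).
Proof.
  intros D1 D2. auto_derive; [repeat split; auto; eexists; eassumption | ].
  rewrite_derive D1; rewrite_derive D2; ring.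
Qed.

Lemma D_y_graph y z : I1 (y + a * z) -> D_y w y z = Derive f (y + a * z) * g z.
Proof.
  intro Iu. apply is_derive_unique.
  replace (Derive f (y + a * z) * g z)
    with (Derive f (y + a * z) * g z + f (y + a * z) * 0) by ring.
  apply (is_derive_product (fun t => f (t + a * z)) (fun _ => g z)).
  - apply is_derive_shift_y. exact (smooth_on_is_derive l1 r1 f _ hf Iu).
  - apply (is_derive_const (g z) y).
Qed.

Lemma D_z_graph y z : I1 (y + a * z) -> I2 z ->
  D_z w y z = a * Derive f (y + a * z) * g z + f (y + a * z) * Derive g z.
Proof.
  intros Iu Iv. apply is_derive_unique.
  apply (is_derive_product (fun t => f (y + a * t)) g).
  - apply is_derive_shift_z. exact (smooth_on_is_derive l1 r1 f _ hf Iu).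
  - exact (smooth_on_is_derive l2 r2 g _ hg Iv).
Qed.

Lemma locally_shift_y y z : I1 (y + a * z) -> locally y (fun t => I1 (t + a * z)).
Proof.
  intro Iu.
  assert (C : continuous (U := R_UniformSpace) (fun t => t + a * z) y).
  { apply (ex_derive_continuous (K := R_AbsRing) (V := R_NormedModule)).
    auto_derive; exact Logic.I. }
  exact (C I1 (open_Rbar_interval_open l1 r1 _ Iu)).
Qed.

Lemma locally_shift_z y z : I1 (y + a * z) -> locally z (fun t => I1 (y + a * t)).
Proof.
  intro Iu.
  assert (C : continuous (U := R_UniformSpace) (fun t => y + a * t) z).
  { apply (ex_derive_continuous (K := R_AbsRing) (V := R_NormedModule)).
    auto_derive; exact Logic.I. }
  exact (C I1 (open_Rbar_interval_open l1 r1 _ Iu)).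
Qed.

Lemma D_yy_graph y z : I1 (y + a * z) ->
  D_y (D_y w) y z = Derive (Derive f) (y + a * z) * g z.
Proof.
  intro Iu. unfold D_y at 1.
  rewrite (Derive_ext_loc _ (fun t => Derive f (t + a * z) * g z)).
  2:{ generalize (locally_shift_y y z Iu). apply filter_imp.
      intros t It. apply D_y_graph; exact It. }
  apply is_derive_unique.
  replace (Derive (Derive f) (y + a * z) * g z)
    with (Derive (Derive f) (y + a * z) * g z + Derive f (y + a * z) * 0) by ring.
  apply (is_derive_product (fun t => Derive f (t + a * z)) (fun _ => g z)).
  - apply is_derive_shift_y. exact (smooth_on_is_derive2 l1 r1 f _ hf Iu).
  - apply (is_derive_const (g z) y).
Qed.

Lemma D_yz_graph y z : I1 (y + a * z) -> I2 z ->
  D_z (D_y w) y z =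
    a * Derive (Derive f) (y + a * z) * g z + Derive f (y + a * z) * Derive g z.
Proof.
  intros Iu Iv. unfold D_z.
  rewrite (Derive_ext_loc _ (fun t => Derive f (y + a * t) * g t)).
  2:{ generalize (locally_shift_z y z Iu). apply filter_imp.
      intros t It. apply D_y_graph; exact It. }
  apply is_derive_unique.
  apply (is_derive_product (fun t => Derive f (y + a * t)) g).
  - apply is_derive_shift_z. exact (smooth_on_is_derive2 l1 r1 f _ hf Iu).
  - exact (smooth_on_is_derive l2 r2 g _ hg Iv).
Qed.

Lemma D_zz_graph y z : I1 (y + a * z) -> I2 z ->
  D_z (D_z w) y z =
    a ^ 2 * Derive (Derive f) (y + a * z) * g z
    + 2 * a * Derive f (y + a * z) * Derive g z
    + f (y + a * z) * Derive (Derive g) z.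
Proof.
  intros Iu Iv. unfold D_z at 1.
  rewrite (Derive_ext_loc _
    (fun t => a * (Derive f (y + a * t) * g t) + f (y + a * t) * Derive g t)).
  2:{ generalize (filter_and _ _ (locally_shift_z y z Iu) (open_Rbar_interval_open l2 r2 z Iv)).
      apply filter_imp.
      intros t [It Jt]. rewrite (D_z_graph y t It Jt). ring. }
  apply is_derive_unique.
  evar_last.
  apply (is_derive_plus (V := R_NormedModule)
    (fun t => a * (Derive f (y + a * t) * g t)) (fun t => f (y + a * t) * Derive g t)).
  - apply is_derive_scal.
    apply (is_derive_product (fun t => Derive f (y + a * t)) g).
    + apply is_derive_shift_z. exact (smooth_on_is_derive2 l1 r1 f _ hf Iu).
    + exact (smooth_on_is_derive l2 r2 g _ hg Iv).
  - apply (is_derive_product (fun t => f (y + a * t)) (Derive g)).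
    + apply is_derive_shift_z. exact (smooth_on_is_derive l1 r1 f _ hf Iu).
    + exact (smooth_on_is_derive2 l2 r2 g _ hg Iv).
  - unfold plus; simpl. ring.
Qed.

Hypothesis hadm : admissible (affine_factorable_domain a I1 I2) w.
Hypothesis hmin : minimal (affine_factorable_domain a I1 I2) w.

(** In the independent variables [u = y + a z] and [v = z] the domain is the
    rectangle [I1 x I2]. *)
Lemma admissible_separated u v : I1 u -> I2 v ->
  a * Derive f u * g v + f u * Derive g v <> 0.
Proof.
  intros Iu Iv.
  assert (e : (u - a * v) + a * v = u) by ring.
  rewrite <- e in Iu.
  generalize (hadm (u - a * v) v (conj Iu Iv)).
  rewrite (D_z_graph _ _ Iu Iv), e. auto.
Qed.

Lemma minimal_separated u v : I1 u -> I2 v ->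
  (a ^ 2 + f u ^ 2 * Derive g v ^ 2) * Derive (Derive f) u * g v
  + 2 * (a - f u * Derive f u * g v * Derive g v) * Derive f u * Derive g v
  + (1 + Derive f u ^ 2 * g v ^ 2) * f u * Derive (Derive g) v = 0.
Proof.
  intros Iu Iv.
  generalize (admissible_separated u v Iu Iv); intro N.
  assert (e : (u - a * v) + a * v = u) by ring.
  rewrite <- e in Iu.
  generalize (hmin (u - a * v) v (conj Iu Iv)).
  unfold isotropic_mean_curvature.
  rewrite (D_zz_graph _ _ Iu Iv), (D_yz_graph _ _ Iu Iv), (D_yy_graph _ _ Iu),
    (D_z_graph _ _ Iu Iv), (D_y_graph _ _ Iu), e.
  intro H.
  apply (Rmult_eq_reg_r (/ (2 * (a * Derive f u * g v + f u * Derive g v) ^ 3))).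
  - rewrite Rmult_0_l, <- H. unfold Rdiv. f_equal. ring.
  - apply Rinv_neq_0_compat. apply Rmult_integral_contrapositive_currified; [lra | ].
    apply pow_nonzero; exact N.
Qed.

(** The products [f' g'] vanish on the whole rectangle, so if [f'] is nonzero at
    one point then [g' = 0] everywhere. *)
Lemma one_factor_constant u v : a <> 0 -> I1 u -> I2 v -> Derive f u * Derive g v = 0.
Proof.
  intros a0 Iu Iv. apply NNPP; intro N.
  assert (df0 : Derive f u <> 0) by (intro K; apply N; rewrite K; ring).
  assert (dg0 : Derive g v <> 0) by (intro K; apply N; rewrite K; ring).
  apply (minimal_profiles_absurd _ _ _ _ _ _ _ _ _ _
    (regular_set_profile l1 r1 f 1 u hf Iu df0 R1_neq_R0)
    (regular_set_profile l2 r2 g a v hg Iv dg0 a0)).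
  - intros s t (Is & fs & ds) (It & gt & dt).
    generalize (minimal_separated s t Is It); intro E.
    apply (Rmult_eq_reg_l (Derive f s ^ 2 * Derive g t ^ 2)).
    2:{ apply Rmult_integral_contrapositive_currified; apply pow_nonzero; auto. }
    rewrite Rmult_0_r.
    transitivity (f s * g t * 0); [ | ring]. rewrite <- E. field. auto.
  - intros s t (Is & fs & ds) (It & gt & dt) K.
    apply (admissible_separated s t Is It).
    replace (_ + _) with (Derive f s * Derive g t *
       (1 * f s / Derive f s + a * g t / Derive g t)) by (field; auto).
    rewrite K; ring.
Qed.

End Graph.

Theorem theorem4p2 (a : R) (l1 r1 l2 r2 : Rbar) (f1 f2 : R -> R)
  (ha : a <> 0)
  (hI1 : Rbar_lt l1 r1) (hI2 : Rbar_lt l2 r2)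
  (hf1 : smooth_on (open_Rbar_interval l1 r1) f1)
  (hf2 : smooth_on (open_Rbar_interval l2 r2) f2)
  (hadm : admissible
     (affine_factorable_domain a (open_Rbar_interval l1 r1) (open_Rbar_interval l2 r2))
     (affine_factorable a f1 f2))
  (hmin : minimal
     (affine_factorable_domain a (open_Rbar_interval l1 r1) (open_Rbar_interval l2 r2))
     (affine_factorable a f1 f2)) :
  part_of_nonisotropic_plane
    (graph_surface
       (affine_factorable_domain a (open_Rbar_interval l1 r1) (open_Rbar_interval l2 r2))
       (affine_factorable a f1 f2)).
Proof.
  assert (A := admissible_separated a l1 r1 l2 r2 f1 f2 hf1 hf2 hadm).
  assert (E := minimal_separated a l1 r1 l2 r2 f1 f2 hf1 hf2 hadm hmin).
  destruct (open_Rbar_interval_inhabited l1 r1 hI1) as [u0 Iu0].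
  destruct (open_Rbar_interval_inhabited l2 r2 hI2) as [v0 Iv0].
  destruct (classic (forall u, open_Rbar_interval l1 r1 u -> Derive f1 u = 0)) as [H | H].
  - assert (C : forall u, open_Rbar_interval l1 r1 u -> f1 u = f1 u0).
    { intros u Iu. apply (constant_on_interval l1 r1); auto.
      intros s Is. rewrite <- (H s Is). exact (smooth_on_is_derive l1 r1 f1 s hf1 Is). }
    assert (c0 : f1 u0 <> 0).
    { intro K. apply (A u0 v0 Iu0 Iv0). rewrite (H u0 Iu0), K; ring. }
    destruct (affine_on_interval l2 r2 f2 hI2 hf2) as (m & k & M).
    { intros v Iv. apply (Rmult_eq_reg_l (f1 u0)); [ | exact c0].
      assert (F2 : Derive (Derive f1) u0 = 0).
      { rewrite <- (Derive_const 0 u0). apply Derive_ext_loc.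
        generalize (open_Rbar_interval_open l1 r1 u0 Iu0). apply filter_imp. exact H. }
      generalize (E u0 v Iu0 Iv). rewrite F2, (H u0 Iu0). lra. }
    exists 1, 0, (- (f1 u0 * m)), (f1 u0 * k). split.
    + intro K. apply (A u0 v0 Iu0 Iv0).
      destruct (M v0 Iv0) as [M1 _]. rewrite M1, (H u0 Iu0). lra.
    + intros x y z [[Iu Iv] ->]. unfold affine_factorable.
      destruct (M z Iv) as [_ ->]. rewrite (C _ Iu). ring.
  - assert (G : forall v, open_Rbar_interval l2 r2 v -> Derive f2 v = 0).
    { intros v Iv. apply not_all_ex_not in H; destruct H as [u H].
      apply imply_to_and in H; destruct H as [Iu du].
      destruct (Rmult_integral _ _
        (one_factor_constant a l1 r1 l2 r2 f1 f2 hf1 hf2 hadm hmin u v ha Iu Iv)); easy. }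
    assert (C : forall v, open_Rbar_interval l2 r2 v -> f2 v = f2 v0).
    { intros v Iv. apply (constant_on_interval l2 r2); auto.
      intros s Is. rewrite <- (G s Is). exact (smooth_on_is_derive l2 r2 f2 s hf2 Is). }
    assert (c0 : f2 v0 <> 0).
    { intro K. apply (A u0 v0 Iu0 Iv0). rewrite (G v0 Iv0), K; ring. }
    destruct (affine_on_interval l1 r1 f1 hI1 hf1) as (m & k & M).
    { intros u Iu.
      assert (F2 : Derive (Derive f2) v0 = 0).
      { rewrite <- (Derive_const 0 v0). apply Derive_ext_loc.
        generalize (open_Rbar_interval_open l2 r2 v0 Iv0). apply filter_imp. exact G. }
      generalize (E u v0 Iu Iv0). rewrite F2, (G v0 Iv0). intro K.
      apply (Rmult_eq_reg_l (a ^ 2 * f2 v0)); [lra | ].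
      apply Rmult_integral_contrapositive_currified; [apply pow_nonzero; exact ha | exact c0]. }
    exists 1, (- (f2 v0 * m)), (- (f2 v0 * m * a)), (f2 v0 * k). split.
    + intro K. apply (A u0 v0 Iu0 Iv0).
      destruct (M u0 Iu0) as [M1 _]. rewrite M1, (G v0 Iv0). lra.
    + intros x y z [[Iu Iv] ->]. unfold affine_factorable.
      destruct (M _ Iu) as [_ ->]. rewrite (C _ Iv). ring.
Qed.
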